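(* Let $d\geqslant 3$ be an odd integer and let $n>1$ be an integer. Then $$\sum_{k=0}^{n-1}[2dk-1]\frac{(q^{-1};q^d)_k^d}{(q^d;q^d)_k^d}\,q^{\frac{d(d-1)k}{2}}\equiv \begin{cases} 0\pmod{\Phi_n(q)^2}, &\text{if } n\equiv 1\pmod{d},\\[5pt] 0\pmod{\Phi_n(q)^3}, &\text{if } n\equiv \tfrac{1}{2}\pmod{d}.\end{cases}$$
   Context: Here $q$ is an indeterminate. Notation: $(a;q)_k=(1-a)(1-aq)\cdots(1-aq^{k-1})$ for $k\ge 1$, $(a;q)_0=1$ (so $(x;q^d)_k=\prod_{i=0}^{k-1}(1-xq^{di})$). For an integer $m$ (possibly negative), $[m]=\frac{1-q^m}{1-q}$; in particular $[-1]=-q^{-1}$. $\Phi_n(q)$ is the $n$-th cyclotomic polynomial in $q$. The condition $n\equiv \frac12\pmod d$ (with $d$ odd) means $2n\equiv 1\pmod d$. For a rational function $A(q)$ and a polynomial $P(q)$, $A(q)\equiv 0\pmod{P(q)}$ means that $A(q)=P(q)U(q)/V(q)$ with polynomials $U,V$ (over $\mathbb{Q}$), where $V$ is relatively prime to $P$ (factors that are powers of $q$ may be allowed in $V$). *)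

(* Defs.v *)
From mathcomp Require Import all_boot all_order all_algebra all_field.

Set Implicit Arguments.
Unset Strict Implicit.
Unset Printing Implicit Defensive.

Import GRing.Theory.
Local Open Scope ring_scope.

Notation ratfrac := {fraction {poly rat}}.

Definition qvar : ratfrac := tofrac 'X.

(* (a; b)_k; the base b is passed explicitly, e.g. b = q ^+ d for (a; q^d)_k. *)
Definition qpoch (K : fieldType) (a b : K) (k : nat) : K :=
  \prod_(i < k) (1 - a * b ^+ i).

Definition qint (K : fieldType) (q : K) (m : int) : K :=
  (1 - q ^ m) / (1 - q).

Definition PhiQ (n : nat) : {poly rat} := map_poly intr 'Phi_n.

(* A = 0 modulo P among rational functions.  When P is coprime to 'X, powers of
   'X are already allowed as factors of V by the coprimality condition. *)
Definition ratfrac_congr0 (A : ratfrac) (P : {poly rat}) : Prop :=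
  exists U V : {poly rat},
    [/\ V != 0, coprimep V P & A = tofrac (P * U) / tofrac V].

(* Main.v *)
Require Import Defs.
From mathcomp Require Import all_boot all_order all_algebra all_field.
From mathcomp Require Import ring zify.

(** Write Q = q^d, h = (d-1)/2, and let t_k be the k-th summand times 1 - q, that
    is t_k = (1 - q^-1 Q^(2k)) ((q^-1;Q)_k / (Q;Q)_k)^d Q^(hk).  In both cases there
    are integers r, M with dM = rn + 1 and M < n: r = d - 1 when n = 1 mod d, and
    r = d - 2 when 2n = 1 mod d.  Since q^-1 Q^M = q^(rn) is 1 modulo Phi_n, the
    summands with k > M are divisible by Phi_n^d, and only k <= M matters.

    The idea is to multiply q^-1 and Q, inside the shifted factorials, by powers
    of y = q^n.  As y = 1 mod Phi_n, this is a small perturbation, and the powers are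
    chosen so that it is invisible to first order, while the perturbed sum
    terminates and vanishes identically.

    - If n = 1 mod d, replace (q^-1)_k^d by (q^-1 y^-r)_k (q^-1 y)_k^r.  The
      exponents of y add up to 0, so the change is O(Phi_n^2).  But
      q^-1 y^-r = Q^-M and q^-1 y = Q^m with m = n - M, so (Q^m)_k / (Q)_k is a
      polynomial in Q^k and the new sum is an M-th Q-difference of a polynomial of
      low degree ([vwp_poly_sum]).
    - If 2n = 1 mod d, replace (q^-1)_k^d by (q^-1 y^-r)_k (q^-1)_k (q^-1 y)_k^r and
      (Q)_k^d by (Q y^r)_k (Q)_k (Q y^-1)_k^r.  The new sum is very-well-poised;
      in the variable q^-1 Q^k + Q^-k it is again a divided difference of a
      polynomial of low degree, hence 0 ([vwp_wp_sum]).  The perturbation now has a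
      second-order term, namely a constant times (y-1)^2 times the sum of t_k E_k,
      where E_k is a sum of second logarithmic derivatives ([pert_factor_expand]).
      At a primitive n-th root of unity E_(M-k) = E_k and t_(M-k) = - t_k, so that
      this sum is divisible by Phi_n ([antisym_sum]), and the total error is
      O(Phi_n^3).

    Both vanishing statements are instances of [vwp_sum], which is Lagrange
    interpolation at the nodes a x^k + x^-k.  Divisibility by Phi_n is handled by
    evaluating rational functions at a primitive n-th root of unity z. *)

Set Implicit Arguments.
Unset Strict Implicit.
Unset Printing Implicit Defensive.
Import GRing.Theory Num.Theory.
Local Open Scope ring_scope.

(** * Vanishing very-well-poised sums *)

Section QPoch.
Context {K : fieldType}.
Implicit Types (a b x : K).

Lemma qpoch0 a b : qpoch a b 0 = 1.
Proof. by rewrite /qpoch big_ord0. Qed.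

Lemma qpochS a b k : qpoch a b k.+1 = qpoch a b k * (1 - a * b ^+ k).
Proof. by rewrite /qpoch big_ord_recr. Qed.

Lemma qpochD a b i j :
  qpoch a b (i + j) = qpoch a b i * qpoch (a * b ^+ i) b j.
Proof.
elim: j => [|j IHj]; first by rewrite addn0 qpoch0 mulr1.
by rewrite addnS !qpochS IHj -!mulrA -exprD.
Qed.

Lemma qpoch_shift a b i j :
  qpoch a b i * qpoch (a * b ^+ i) b j = qpoch a b j * qpoch (a * b ^+ j) b i.
Proof. by rewrite -!qpochD addnC. Qed.

Lemma qpoch_neq0 a b k :
  (forall i, (i < k)%N -> 1 - a * b ^+ i != 0) -> qpoch a b k != 0.
Proof. by move=> nz; apply/prodf_neq0 => i _; apply: nz. Qed.

(** The interpolating polynomial of p has formal degree M, and its coefficient in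
    degree M, which is the sum below, must vanish when p has smaller degree. *)
Lemma lagrange_sum M (Y : nat -> K) (p : {poly K}) :
    (forall i j, (i < M.+1)%N -> (j < M.+1)%N -> Y i = Y j -> i = j) ->
    (size p <= M)%N ->
  \sum_(k < M.+1) p.[Y k] / \prod_(j < M.+1 | j != k) (Y k - Y j) = 0.
Proof.
move=> injY sz_p.
pose N (k : 'I_M.+1) := \prod_(j < M.+1 | j != k) ('X - (Y j)%:P).
have N_monic (k : 'I_M.+1) : N k \is monic by apply: monic_prod => j _; rewrite monicXsubC.
have sizeN (k : 'I_M.+1) : size (N k) = M.+1.
  have -> : N k = \prod_(j <- enum (predC1 k)) ('X - (Y j)%:P) by rewrite big_enum.
  by rewrite size_prod_XsubC -cardE cardC1 card_ord.
have N_node (k : 'I_M.+1) : (N k).[Y k] = \prod_(j < M.+1 | j != k) (Y k - Y j).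
  by rewrite horner_prod; apply: eq_bigr => j _; rewrite hornerXsubC.
have D_neq0 (k : 'I_M.+1) : (N k).[Y k] != 0.
  rewrite N_node; apply/prodf_neq0 => j; apply: contra; rewrite subr_eq0.
  by move/eqP/injY=> Ekj; apply/eqP/val_inj; rewrite /= Ekj.
pose L := \sum_(k < M.+1) (p.[Y k] / (N k).[Y k]) *: N k.
have pL : p = L.
  apply/eqP; rewrite -subr_eq0; apply/negPn/negP => nz.
  have := @max_poly_roots _ (p - L) [seq Y (val k) | k <- enum 'I_M.+1] nz.
  rewrite size_map size_enum_ord map_inj_in_uniq ?enum_uniq; last first.
    move=> i j _ _ E; apply: val_inj; exact: injY (ltn_ord i) (ltn_ord j) E.
  move/(_ _ isT); rewrite ltnNge => /(_ _)/negP[]; last first.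
    rewrite (leq_trans (size_polyD _ _)) // size_polyN geq_max leqW //=.
    apply: (leq_trans (size_sum _ _ _)); apply/bigmax_leqP => k _.
    by rewrite (leq_trans (size_scale_leq _ _)) ?sizeN.
  apply/allP => _ /mapP[k _ ->]; rewrite rootE hornerD hornerN subr_eq0.
  rewrite horner_sum (bigD1 k) //= hornerZ divfK // big1 ?addr0 ?subrr // => j jk.
  rewrite hornerZ [X in _ * X]horner_prod (bigD1 k) 1?eq_sym //= hornerXsubC.
  by rewrite subrr mul0r mulr0.
have := congr1 (fun f : {poly K} => f`_M) pL.
rewrite /= (nth_default _ sz_p) coef_sum => E; rewrite [RHS]E.
apply: eq_bigr => k _; rewrite coefZ N_node.
by have /monicP := N_monic k; rewrite /lead_coef sizeN /= => ->; rewrite mulr1.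
Qed.

Section VeryWellPoised.
Context (a x : K) (M : nat).
Hypothesis x_neq0 : x != 0.
Hypothesis x_nroot : forall j, (0 < j <= M)%N -> x ^+ j != 1.
Hypothesis a_ok : forall j, (j <= M.*2)%N -> 1 - a * x ^+ j != 0.

Let Y k := a * x ^+ k + x ^- k.

Let w N k := (1 - a * x ^+ k.*2) * qpoch (x ^- N) x k * qpoch a x k
   / (qpoch x x k * qpoch (a * x ^+ N.+1) x k) * x ^+ (k * N).

Let Yk_sub k j : Y k - Y j = (1 - x ^+ k / x ^+ j) * x ^- k * (1 - a * x ^+ (k + j)).
Proof. by rewrite /Y exprD; field; rewrite !expf_neq0. Qed.

Let x_poch k : (k <= M)%N -> qpoch x x k != 0.
Proof.
move=> leM; apply: qpoch_neq0 => i ltik.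
by rewrite -exprS subr_eq0 eq_sym x_nroot //; lia.
Qed.

Let a_poch i k : (i + k <= M.*2.+1)%N -> qpoch (a * x ^+ i) x k != 0.
Proof.
move=> leM; apply: qpoch_neq0 => j ltjk.
by rewrite -mulrA -exprD a_ok //; lia.
Qed.

(** Up to a factor independent of k, the very-well-poised weights are the Lagrange
    weights of the nodes.  The proof is by induction on N, starting from N = k: the new
    node multiplies both sides by the same factor. *)
Lemma vwp_node_prod N k : (k <= N <= M)%N ->
  (\prod_(j < N.+1 | j != k :> nat) (Y k - Y j)) * w N k
    = qpoch a x N.+1 * \prod_(j < N) (1 - x ^- j.+1).
Proof using K a x M Y w x_neq0 x_nroot a_ok.
move=> /andP[/subnKC <-]; elim: (N - k)%N => [|e IH] leM.
  rewrite addn0 in leM *; rewrite big_mkcond big_ord_recr /= eqxx mulr1.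
  rewrite (eq_bigr (fun j : 'I_k => (x ^- k * (1 - x ^+ (k.-1 - j).+1)) * (1 - a * x ^+ k * x ^+ j))); last first.
    move=> j _; rewrite neq_ltn ltn_ord Yk_sub; congr (_ * _); last by rewrite exprD mulrA.
    have -> : (k.-1 - j).+1 = (k - j)%N by have := ltn_ord j; lia.
    by rewrite expfB // mulrC.
  rewrite !big_split /= prodr_const card_ord -/(qpoch (a * x ^+ k) x k).
  have -> : \prod_(j < k) (1 - x ^+ (k.-1 - j).+1) = qpoch x x k.
    rewrite (reindex_inj rev_ord_inj) /=; apply: eq_bigr => j _.
    rewrite -exprS; congr (1 - x ^+ _); have := ltn_ord j; lia.
  have rev_k : qpoch (x ^- k) x k = \prod_(j < k) (1 - x ^- j.+1).
    rewrite /qpoch (reindex_inj rev_ord_inj) /=; apply: eq_bigr => j _.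
    congr (1 - _).
    have {1}-> : k = (j.+1 + (k - j.+1))%N by have := ltn_ord j; lia.
    by rewrite exprD invfM mulfVK ?expf_neq0.
  have shift : qpoch (a * x ^+ k) x k * (1 - a * x ^+ k.*2)
      = (1 - a * x ^+ k) * qpoch (a * x ^+ k.+1) x k.
    have := qpoch_shift (a * x ^+ k) x k 1.
    by rewrite !qpochS !qpoch0 !mul1r !expr1 expr0 mulr1 -!mulrA -exprD addnn -exprSr !mulr1.
  rewrite /w rev_k (qpochS a x k) exprM exprVn; set P := \prod_(_ < _) _.
  have nz1 : qpoch x x k != 0 by apply: x_poch; lia.
  have nz2 : qpoch (a * x ^+ k.+1) x k != 0 by apply: a_poch; lia.
  apply: (mulIf nz2); transitivity (qpoch a x k * (qpoch (a * x ^+ k) x k * (1 - a * x ^+ k.*2)) * P).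
    by field; rewrite nz1 nz2 expf_neq0 ?expf_neq0.
  by rewrite shift; ring.
rewrite addnS big_mkcond big_ord_recr /= -big_mkcond /=.
rewrite addnS in leM; set L := (k + e)%N in IH leM *.
have -> /= : L.+1 != k by rewrite /L; lia.
have {}IH := IH (ltnW leM).
rewrite [\prod_(j < L.+1) _]big_ord_recr qpochS /=.
rewrite [RHS]mulrACA -IH.
have wS : (Y k - Y L.+1) * w L.+1 k = w L k * ((1 - a * x ^+ L.+1) * (1 - x ^- L.+1)).
  have s1 := qpoch_shift (x ^- L.+1) x k 1.
  have s2 := qpoch_shift (a * x ^+ L.+1) x k 1.
  rewrite !qpochS !qpoch0 !mul1r !expr1 !expr0 !mulr1 in s1 s2.
  have x1 : x ^- L.+1 * x = x ^- L by rewrite exprS invfM mulrAC mulVf // mul1r.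
  have a1 : a * x ^+ L.+1 * x = a * x ^+ L.+2 by rewrite -mulrA -exprSr.
  rewrite x1 in s1; rewrite a1 in s2.
  rewrite /w Yk_sub exprD (mulnS k) exprD mulrA.
  have nz1 : qpoch x x k != 0 by apply: x_poch; lia.
  have nz2 : qpoch (a * x ^+ L.+1) x k != 0 by apply: a_poch; lia.
  have nz3 : qpoch (a * x ^+ L.+2) x k != 0 by apply: a_poch; lia.
  move: nz1 nz2 nz3 s1 s2; set A := qpoch (x ^- L.+1) x k; set B := qpoch (a * x ^+ L.+1) x k.
  set A' := qpoch (x ^- L) x k; set B' := qpoch (a * x ^+ L.+2) x k => nz1 nz2 nz3 s1 s2.
  rewrite (mulrC (x ^+ k) (x ^- _)).
  transitivity ((A * (1 - x ^- L.+1 * x ^+ k)) * (B * (1 - a * x ^+ L.+1 * x ^+ k)) / (B * B')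
     * (1 - a * x ^+ k.*2) * qpoch a x k / qpoch x x k * x ^+ (k * L)).
    by field; rewrite nz1 nz2 nz3 !expf_neq0.
  rewrite s1 s2.
  by field; rewrite nz1 nz2 nz3 !expf_neq0.
by rewrite -[LHS]mulrA wS [LHS]mulrA.
Qed.

(** The very-well-poised sums that vanish: they are divided differences of p at
    M + 1 nodes.  For a = 0 this is the vanishing of the M-th x-difference of a
    polynomial. *)
Lemma vwp_sum (p : {poly K}) : (size p <= M)%N ->
  \sum_(k < M.+1)
     (1 - a * x ^+ k.*2)
     * (qpoch (x ^- M) x k * qpoch a x k / (qpoch x x k * qpoch (a * x ^+ M.+1) x k))
     * x ^+ (k * M) * p.[a * x ^+ k + x ^- k] = 0.
Proof.
move=> sz_p.
have injY i j : (i < M.+1)%N -> (j < M.+1)%N -> Y i = Y j -> i = j.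
  wlog leij : i j / (j <= i)%N.
    by move=> H iM jM E; case/orP: (leq_total i j) => le; [symmetry|]; apply: H.
  move=> iM jM /eqP; rewrite -subr_eq0 Yk_sub !mulf_eq0.
  rewrite invr_eq0 (negPf (expf_neq0 i x_neq0)) orbF.
  have /negPf-> : 1 - a * x ^+ (i + j) != 0 by apply: a_ok; lia.
  rewrite orbF; case: ltngtP leij => // ltij _.
  by rewrite -expfB // subr_eq0 eq_sym (negPf (x_nroot _)) //; lia.
set C := qpoch a x M.+1 * \prod_(j < M) (1 - x ^- j.+1).
have C_neq0 : C != 0.
  rewrite mulf_neq0 //; first by rewrite -[a]mulr1 -(expr0 x) a_poch //; lia.
  apply/prodf_neq0 => j _; rewrite subr_eq0 eq_sym invr_eq1 x_nroot //.
  by have := ltn_ord j; lia.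
apply: (mulfI (invr_neq0 C_neq0)); rewrite mulr0 -[RHS](lagrange_sum injY sz_p).
rewrite mulr_sumr; apply: eq_bigr => k _.
have Ck : \prod_(j < M.+1 | j != k) (Y k - Y j) * w M k = C.
  by apply: (@vwp_node_prod M k); rewrite -ltnS ltn_ord leqnn.
have nzw : w M k != 0 by apply: contraNneq C_neq0 => w0; rewrite -Ck w0 mulr0.
rewrite mulrA mulrC; congr (_ * _); rewrite -Ck invfM.
by rewrite [X in _ * (X * _)]mulrA [X in _ * (X * _ * _)]mulrA -/(w M k) mulfVK.
Qed.
End VeryWellPoised.

Lemma qpoch0l x k : qpoch 0 x k = 1.
Proof. by rewrite /qpoch big1 // => i _; rewrite mul0r subr0. Qed.

(** For a positive shift m, the ratio is a polynomial of degree m - 1 in x ^+ k. *)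
Lemma qpoch_ratio y x m k : (0 < m)%N ->
    qpoch (y * x) x k != 0 -> qpoch (y * x) x m.-1 != 0 ->
  qpoch (y * x ^+ m) x k / qpoch (y * x) x k
    = qpoch (y * x ^+ k.+1) x m.-1 / qpoch (y * x) x m.-1.
Proof.
case: m => // m _ /= nz1 nz2; apply/eqP; rewrite eqr_div // !exprS !mulrA.
by rewrite mulrC -qpoch_shift mulrC.
Qed.

Lemma size_prod_ord_XsubC n (c : nat -> K) :
  size (\prod_(i < n) ('X - (c i)%:P)) = n.+1.
Proof.
elim: n => [|n IHn]; first by rewrite big_ord0 size_poly1.
by rewrite big_ord_recr /= size_Mmonic ?monicXsubC -?size_poly_gt0 ?IHn // size_XsubC addn2.
Qed.

(** The case a = 0 of [vwp_sum]: in terms of x ^- k, the summand is the Lagrange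
    weight times a polynomial of degree e * m + 1 - h. *)
Lemma vwp_poly_sum c x e h m : x != 0 -> (0 < h < e)%N -> (0 < m)%N ->
    (forall j, (0 < j <= (e * m).+1)%N -> x ^+ j != 1) ->
  \sum_(k < (e * m).+2)
     (1 - c * x ^+ k.*2) * (qpoch (x ^- (e * m).+1) x k / qpoch x x k)
     * (qpoch (x ^+ m) x k / qpoch x x k) ^+ e * x ^+ (h * k) = 0.
Proof.
move=> x0 h_lt m_gt0 x_nroot; set M := (e * m).+1 in x_nroot *.
pose g := \prod_(i < m.-1) ('X - (x ^+ i.+1)%:P).
pose p := 'X ^+ (e - h).-1 * ('X ^+ 2 - c%:P) * g ^+ e.
have szg : size g = m by rewrite /g (size_prod_ord_XsubC _ (fun i => x ^+ i.+1)) prednK.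
have sz_p : (size p <= M)%N.
  have szg' : (size (g ^+ e) <= (m.-1 * e).+1)%N.
    by rewrite (leq_trans (size_poly_exp_leq _ _)) // szg.
  rewrite (leq_trans (size_polyMleq _ _)) // -ltnS.
  have : (size ('X ^+ (e - h).-1 * ('X ^+ 2 - c%:P) : {poly K})%R <= (e - h) + 2)%N.
    by rewrite (leq_trans (size_polyMleq _ _)) // size_polyXn size_XnsubC //; lia.
  rewrite /M; move: szg' m_gt0 h_lt; move: (size _) (size _) => s1 s2.
  by case: (m) => // m' /=; nia.
have a_ok j : (j <= M.*2)%N -> 1 - 0 * x ^+ j != 0 by rewrite mul0r subr0 oner_neq0.
have x_poch k : (k <= M)%N -> qpoch x x k != 0.
  move=> leM; apply: qpoch_neq0 => i ltik.
  by rewrite -exprS subr_eq0 eq_sym x_nroot //; lia.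
have gE k : x ^+ (k * m.-1) * g.[x ^- k] = qpoch (x ^+ k.+1) x m.-1.
  rewrite exprM -[in x ^+ k ^+ _](card_ord m.-1) -prodr_const.
  rewrite horner_prod -big_split /=; apply: eq_bigr => i _.
  by rewrite hornerXsubC mulrBr divff ?expf_neq0 // -!exprD addnS addSn.
have nz1 : qpoch (1 * x) x m.-1 != 0.
  rewrite mul1r x_poch // /M; have : (m <= e * m)%N by apply: leq_pmull; lia.
  lia.
apply: (mulfI (expf_neq0 e nz1)).
rewrite mulr0 -[RHS](vwp_sum x0 x_nroot a_ok sz_p) mulr_sumr.
apply: eq_bigr => k _; rewrite !mul0r !qpoch0l add0r subr0 mul1r !mulr1.
have nz2 : qpoch (1 * x) x k != 0 by rewrite mul1r x_poch // -ltnS.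
have := qpoch_ratio m_gt0 nz2 nz1; rewrite !mul1r => ->; rewrite mul1r in nz1 nz2.
rewrite expr_div_n -gE.
rewrite /p !hornerM hornerXn hornerD hornerN hornerC hornerXn horner_exp.
have kM j : (j * M)%N = (j * m.-1 * e + j * 2 + j * (e - h).-1 + h * j)%N.
  by rewrite /M; case: (m) m_gt0 => // m' _ /=; nia.
rewrite {}kM.
rewrite -muln2 !exprD [x ^+ (_ * e)]exprM exprMn !exprVn ![x ^+ (k * _)]exprM.
by field; rewrite !expf_neq0 ?nz1 ?nz2.
Qed.

(** The relation between y and a makes the roots of the polynomial
    (y x ^+ k.+1; x)_(2l) come in pairs with product 1/a, so that it is a power
    of x ^+ k times a polynomial of degree l in the node a x ^+ k + x ^- k.  The
    length h + r * l is the one for which the powers of x ^+ k cancel. *)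
Lemma vwp_wp_sum a y x h l r : x != 0 -> (0 < h)%N ->
    y ^+ 2 * x ^+ l.*2.+1 = a ->
    (forall j, (0 < j <= h + r * l)%N -> x ^+ j != 1) ->
    (forall j, (j <= (h + r * l).*2)%N -> 1 - a * x ^+ j != 0) ->
    (forall j, 1 - y * x ^+ j != 0) ->
  \sum_(k < (h + r * l).+1)
     (1 - a * x ^+ k.*2)
     * (qpoch (x ^- (h + r * l)) x k * qpoch a x k
        / (qpoch x x k * qpoch (a * x ^+ (h + r * l).+1) x k))
     * (qpoch (y * x ^+ l.*2.+1) x k / qpoch (y * x) x k) ^+ r * x ^+ (h * k) = 0.
Proof.
move=> x0 h_gt0 ya x_nroot a_ok y_ok; set M := (h + r * l)%N in x_nroot a_ok *.
pose g := \prod_(i < l) ('X - (y * (x ^+ i.+1 + x ^+ (l.*2 - i)))%:P).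
have szg : size g = l.+1 by exact: (size_prod_ord_XsubC _ (fun i => y * (x ^+ i.+1 + x ^+ (l.*2 - i)))).
have sz_p : (size (g ^+ r) <= M)%N.
  by rewrite (leq_trans (size_poly_exp_leq _ _)) // szg /M; lia.
have y_poch k : qpoch (y * x) x k != 0.
  by apply: qpoch_neq0 => j _; rewrite -mulrA -exprS.
have gE k : x ^+ (k * l) * g.[a * x ^+ k + x ^- k] = qpoch (y * x ^+ k.+1) x l.*2.
  rewrite -addnn qpochD exprM -[in x ^+ k ^+ l](card_ord l) -prodr_const.
  rewrite horner_prod [X in _ = _ * X](reindex_inj rev_ord_inj) /= -!big_split /=.
  apply: eq_bigr => i _; rewrite hornerXsubC.
  have -> : y * x ^+ k.+1 * x ^+ l * x ^+ (l - i.+1) = y * (x ^+ k * x ^+ (l.*2 - i)).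
    by rewrite -!mulrA -!exprD; congr (_ * _ ^+ _); have := ltn_ord i; lia.
  have -> : a = y ^+ 2 * (x ^+ i.+1 * x ^+ (l.*2 - i)).
    by rewrite -ya -exprD; congr (_ * _ ^+ _); have := ltn_ord i; lia.
  by rewrite !exprS; field; rewrite expf_neq0.
apply: (mulfI (expf_neq0 r (y_poch l.*2))).
rewrite mulr0 -[RHS](vwp_sum x0 x_nroot a_ok sz_p) mulr_sumr.
apply: eq_bigr => k _; rewrite qpoch_ratio //= expr_div_n -gE.
have kM j : (j * M)%N = (j * l * r + h * j)%N by rewrite /M; nia.
rewrite horner_exp {}kM exprD [x ^+ (_ * r)]exprM exprMn.
set W := _ / (qpoch x x k * _).
by field; rewrite expf_neq0.
Qed.
End QPoch.

(** * Order of vanishing at a root of unity *)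

(** Evaluation at z of the rational functions that are regular there, as a relation:
    all the rational functions met below come with an explicit value, so that no
    partial evaluation function is needed. *)
Definition specializes (z : algC) (A : ratfrac) (a : algC) : Prop :=
  exists U V : {poly rat},
    [/\ (map_poly ratr V).[z] != 0, A = tofrac U / tofrac V
      & a = (map_poly ratr U).[z] / (map_poly ratr V).[z]].

Section Specialization.
Context (z : algC).
Implicit Types (A B : ratfrac) (a b : algC) (U V : {poly rat}).
Local Notation "U .[<z>]" := (map_poly ratr U).[z] (at level 2).

Let tofrac_neq0 V : V.[<z>] != 0 -> tofrac V != 0.
Proof. by rewrite tofrac_eq0; apply: contraNneq => ->; rewrite rmorph0 horner0. Qed.

Lemma spec_poly U : specializes z (tofrac U) U.[<z>].
Proof.
exists U, 1; split; rewrite ?rmorph1 ?hornerC ?oner_neq0 //.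
  by rewrite ?rmorph1 divr1.
by rewrite divr1.
Qed.

Lemma spec_q : specializes z qvar z.
Proof. by have := spec_poly 'X; rewrite map_polyX hornerX. Qed.

Lemma spec_nat k : specializes z k%:R k%:R.
Proof. by have := spec_poly k%:R; rewrite !rmorph_nat -polyC_natr hornerC. Qed.

Lemma spec0 : specializes z 0 0. Proof. exact: spec_nat 0. Qed.
Lemma spec1 : specializes z 1 1. Proof. exact: spec_nat 1. Qed.

Lemma specD A a B b : specializes z A a -> specializes z B b -> specializes z (A + B) (a + b).
Proof.
move=> [U1 [V1 [nz1 -> ->]]] [U2 [V2 [nz2 -> ->]]].
exists (U1 * V2 + U2 * V1), (V1 * V2).
rewrite !(rmorphD, rmorphM) !(hornerD, hornerM) mulf_neq0 //.
by split=> //; rewrite addf_div // tofrac_neq0.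
Qed.

Lemma specN A a : specializes z A a -> specializes z (- A) (- a).
Proof.
move=> [U [V [nz -> ->]]]; exists (- U), V.
by rewrite !rmorphN hornerN !mulNr.
Qed.

Lemma specB A a B b : specializes z A a -> specializes z B b -> specializes z (A - B) (a - b).
Proof. by move=> sA sB; apply: specD => //; apply: specN. Qed.

Lemma specM A a B b : specializes z A a -> specializes z B b -> specializes z (A * B) (a * b).
Proof.
move=> [U1 [V1 [nz1 -> ->]]] [U2 [V2 [nz2 -> ->]]].
exists (U1 * U2), (V1 * V2); rewrite !rmorphM !hornerM mulf_neq0 //.
by split=> //; rewrite mulf_div.
Qed.

Lemma specV A a : a != 0 -> specializes z A a -> specializes z A^-1 a^-1.
Proof.
move=> nza [U [V [nz -> Ea]]]; exists V, U; split; rewrite ?Ea ?invf_div //.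
by move: nza; rewrite Ea mulf_eq0 negb_or => /andP[].
Qed.

Lemma spec_neq0 A a : specializes z A a -> a != 0 -> A != 0.
Proof.
move=> [U [V [nz -> ->]]]; rewrite mulf_eq0 negb_or => /andP[nzU _].
by rewrite mulf_neq0 ?invr_eq0 ?tofrac_neq0.
Qed.

Lemma specX A a k : specializes z A a -> specializes z (A ^+ k) (a ^+ k).
Proof.
move=> sA; elim: k => [|k IHk]; first exact: spec1.
by rewrite !exprS; apply: specM.
Qed.

Lemma spec_div A a B b : b != 0 -> specializes z A a -> specializes z B b -> specializes z (A / B) (a / b).
Proof. by move=> nzb sA sB; apply: specM sA _; apply: specV. Qed.

Lemma spec_sum k (F : nat -> ratfrac) (f : nat -> algC) :
    (forall i, (i < k)%N -> specializes z (F i) (f i)) ->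
  specializes z (\sum_(i < k) F i) (\sum_(i < k) f i).
Proof.
elim: k => [|k IHk] sF; first by rewrite !big_ord0; apply: spec0.
rewrite !big_ord_recr /=; apply: specD; last exact: sF.
by apply: IHk => i /ltnW; apply: sF.
Qed.

Lemma spec_qpoch A a B b k : specializes z A a -> specializes z B b ->
  specializes z (qpoch A B k) (qpoch a b k).
Proof.
move=> sA sB; elim: k => [|k IHk]; first by rewrite !qpoch0; apply: spec1.
rewrite !qpochS; apply: specM IHk _; apply: specB spec1 _.
by apply: specM sA _; apply: specX.
Qed.
End Specialization.

(** The Phi_n-adic order of A is at least e: the cofactor is regular at z. *)
Definition ord_ge n z e (A : ratfrac) : Prop :=
  exists B b, specializes z B b /\ A = tofrac (PhiQ n) ^+ e * B.

Section Order.
Context (n : nat) (z : algC).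
Hypothesis z_prim : n.-primitive_root z.
Implicit Types (A B y t g : ratfrac) (e : nat).
Local Notation ord_ge := (ord_ge n z).

Let PhiQ_minpoly (U : {poly rat}) :
  ((map_poly ratr U).[z] == 0) = (PhiQ n %| U)%R.
Proof.
have [p [Dp p_mon] dv_p] := minCpolyP z.
have -> : PhiQ n = p.
  apply: (map_poly_inj (ratr : {rmorphism rat -> algC})).
  rewrite -Dp (minCpoly_cyclotomic z_prim) -(Cintr_Cyclotomic z_prim) /PhiQ -map_poly_comp.
  by apply: eq_map_poly => i; rewrite /= ratr_int.
exact: dv_p.
Qed.

Lemma ord0_spec A a : specializes z A a -> ord_ge 0 A.
Proof. by move=> sA; exists A, a; rewrite mul1r. Qed.

(** The polynomial Phi_n is the minimal polynomial of z over the rationals. *)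
Lemma ord1_spec A : specializes z A 0 -> ord_ge 1 A.
Proof.
move=> [U [V [nz -> /esym/eqP]]]; rewrite mulf_eq0 invr_eq0 (negPf nz) orbF.
rewrite PhiQ_minpoly => /dvdpP[W ->].
exists (tofrac W / tofrac V), ((map_poly ratr W).[z] / (map_poly ratr V).[z]).
by split; [exists W, V | rewrite rmorphM mulrAC mulrC mulrA].
Qed.

Lemma ord_spec0 e A : ord_ge e.+1 A -> specializes z A 0.
Proof.
move=> [B [b [sB ->]]].
have -> : 0 = 0 ^+ e.+1 * b by rewrite expr0n mul0r.
apply: specM => //; apply: specX; have /eqP<- : (map_poly ratr (PhiQ n)).[z] == 0.
  by rewrite PhiQ_minpoly.
exact: spec_poly.
Qed.

Lemma ord_zero e : ord_ge e 0.
Proof. by exists 0, 0; rewrite mulr0; split=> //; apply: spec0. Qed.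

Lemma ordD e A B : ord_ge e A -> ord_ge e B -> ord_ge e (A + B).
Proof.
move=> [A' [a [sA ->]]] [B' [b [sB ->]]]; exists (A' + B'), (a + b).
by rewrite mulrDr; split=> //; apply: specD.
Qed.

Lemma ordN e A : ord_ge e A -> ord_ge e (- A).
Proof.
by move=> [A' [a [sA ->]]]; exists (- A'), (- a); rewrite mulrN; split=> //; apply: specN.
Qed.

Lemma ordB e A B : ord_ge e A -> ord_ge e B -> ord_ge e (A - B).
Proof. by move=> oA oB; apply: ordD => //; apply: ordN. Qed.

Lemma ordM e f A B : ord_ge e A -> ord_ge f B -> ord_ge (e + f) (A * B).
Proof.
move=> [A' [a [sA ->]]] [B' [b [sB ->]]]; exists (A' * B'), (a * b).
by rewrite mulrACA exprD; split=> //; apply: specM.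
Qed.

Lemma ordMl e A B : ord_ge 0 A -> ord_ge e B -> ord_ge e (A * B).
Proof. exact: ordM. Qed.

Lemma ordMr e A B : ord_ge e A -> ord_ge 0 B -> ord_ge e (A * B).
Proof. by rewrite mulrC => oA oB; apply: ordMl. Qed.

Lemma ord_leq e f A : (f <= e)%N -> ord_ge e A -> ord_ge f A.
Proof.
move=> /subnKC <- [B [b [sB ->]]].
exists (tofrac (PhiQ n) ^+ (e - f) * B), ((map_poly ratr (PhiQ n)).[z] ^+ (e - f) * b).
by split; [apply: specM => //; apply: specX; apply: spec_poly | rewrite exprD mulrA].
Qed.

Lemma ordX e k A : ord_ge e A -> ord_ge (e * k) (A ^+ k).
Proof.
move=> oA; elim: k => [|k IHk]; first by rewrite muln0; apply: ord0_spec (spec1 z).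
by rewrite mulnS exprS; apply: ordM.
Qed.

Lemma ord_sum e k (F : nat -> ratfrac) :
  (forall i, (i < k)%N -> ord_ge e (F i)) -> ord_ge e (\sum_(i < k) F i).
Proof.
elim: k => [|k IHk] oF; first by rewrite big_ord0; apply: ord_zero.
rewrite big_ord_recr; apply: ordD; last exact: oF.
by apply: IHk => i /ltnW; apply: oF.
Qed.

Lemma ord_congr0 e A : ord_ge e A -> ratfrac_congr0 A (PhiQ n ^+ e).
Proof.
move=> [B [b [[U [V [nz -> _]]] ->]]]; exists U, V; split.
- by apply: contraNneq nz => ->; rewrite rmorph0 horner0.
- apply: coprimep_expr; rewrite coprimep_sym.
  (* The cofactor of the common divisor is the one that vanishes at z, hence
     PhiQ n divides it and the common divisor is constant. *)
  have Phi0 : PhiQ n != 0 by rewrite map_poly_eq0_id0 ?intr_eq0 ?lead_coef_eq0 monic_neq0 ?Cyclotomic_monic.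
  have /dvdpP[W Dphi] := dvdp_gcdl (PhiQ n) V; have /dvdpP[W' DV] := dvdp_gcdr (PhiQ n) V.
  move: nz; rewrite [in X in X -> _]DV rmorphM hornerM mulf_eq0 negb_or => /andP[_ nzG].
  have : (map_poly ratr (PhiQ n)).[z] == 0 by rewrite PhiQ_minpoly.
  rewrite [X in map_poly _ X]Dphi rmorphM hornerM mulf_eq0 (negPf nzG) orbF PhiQ_minpoly.
  have W0 : W != 0 by apply: contraNneq Phi0 => W0; rewrite Dphi W0 mul0r.
  have G0 : gcdp (PhiQ n) V != 0 by rewrite gcdp_eq0 negb_and Phi0.
  have szPhi : size (PhiQ n) = (size W + size (gcdp (PhiQ n) V)).-1.
    by rewrite [in LHS]Dphi size_mul.
  move/(dvdp_leq W0); rewrite szPhi /coprimep.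
  move: W0 G0; rewrite -!size_poly_gt0; move: (size W) (size (gcdp _ _)) => s t.
  by clear; lia.
- by rewrite rmorphM rmorphXn mulrA.
Qed.

End Order.

(** * Second-order expansion of the perturbation *)

(** Minus the second logarithmic derivative, with respect to the logarithm of y, of
    1 - t * y at y = 1. *)
Definition log_curv (K : fieldType) (t : K) : K := t / (1 - t) ^+ 2.

(** The relative change of (1 - t) ^+ r.+1 when one factor has t divided by y ^+ r
    and the r others have t multiplied by y: to first order in y - 1 these
    changes compensate. *)
Definition pert_factor (K : fieldType) (y : K) r (t : K) : K :=
  (1 - t / y ^+ r) * (1 - t * y) ^+ r / (1 - t) ^+ r.+1.

Lemma mulr_bin2 (R : pzRingType) r : ('C(r, 2)%:R * 2 + r%:R : R) = r%:R ^+ 2.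
Proof.
rewrite -natrM -natrD -natrX; congr _%:R.
by elim: r => // r IHr; rewrite binS bin1; lia.
Qed.

(** Here b and r' stand for the first binomial coefficients, while c1 and c2 are
    the remainders of the binomial expansions.  To second order in w = y - 1,
    all that has to cancel is the multiple b * 2 + r' - r' ^+ 2 of w ^+ 2. *)
Lemma pert_factor_identity (K : fieldType) (y t b r' c1 c2 : K) r :
    let u := t / (1 - t) in let w := y - 1 in
    let k := (b + r') * u * (1 + u) in
    let v := b * u - u ^+ 2 * w * c2 in
    y != 0 -> 1 - t != 0 -> b * 2 + r' = r' ^+ 2 ->
    (1 + w) ^+ r = 1 + r' * w + b * w ^+ 2 + w ^+ 3 * c1 ->
    (1 + - (u * w)) ^+ r
      = 1 + r' * (- (u * w)) + b * (- (u * w)) ^+ 2 + (- (u * w)) ^+ 3 * c2 ->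
  pert_factor y r t - (1 - (b + r') * log_curv t * (w * (1 - y^-1)))
    = w ^+ 3 * ((u * (c1 - u ^+ 2 * c2)
                 + (1 + u) * u * ((b + w * c1) * (- r' + w * v) + r' * v)
                 + k * (r' + b * w + w ^+ 2 * c1)) / y ^+ r - k / y).
Proof.
move=> u w k v y0 t1 br Dc1 Dc2.
have y_w : y = 1 + w by rewrite /w addrC subrK.
have -> : pert_factor y r t = (1 + (1 + u) * (y ^+ r - 1)) * (1 - u * w) ^+ r / y ^+ r.
  rewrite /pert_factor /u /w exprS.
  have -> : 1 - t * y = (1 - t) * (1 - t / (1 - t) * (y - 1)) by field.
  by rewrite exprMn; field; rewrite t1 !expf_neq0.
have -> : log_curv t = u * (1 + u) by rewrite /log_curv /u; field.
set G := _ + k * _.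
have key : (1 + (1 + u) * (y ^+ r - 1)) * (1 - u * w) ^+ r
    = y ^+ r * (1 - k * w ^+ 2) + w ^+ 3 * G + w ^+ 2 * u * (1 + u) * (b * 2 + r' - r' ^+ 2).
  by rewrite y_w Dc1 Dc2 /G /k /v; ring.
rewrite br subrr mulr0 addr0 in key.
rewrite {}key; have yr0 : y ^+ r != 0 by rewrite expf_neq0.
by rewrite /k; clearbody G; rewrite /w; field; rewrite y0 yr0.
Qed.

Lemma prod_pert_factor (K : fieldType) (y a x : K) r k :
  \prod_(i < k) pert_factor y r (a * x ^+ i)
    = qpoch (a / y ^+ r) x k * qpoch (a * y) x k ^+ r / qpoch a x k ^+ r.+1.
Proof.
elim: k => [|k IHk]; first by rewrite big_ord0 !qpoch0 !expr1n divr1 mulr1.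
rewrite big_ord_recr IHk !qpochS !exprMn invfM /pert_factor /=.
rewrite [a / _ * _]mulrAC [a * y * _]mulrAC; ring.
Qed.

Ltac ord_regular :=
  repeat first
  [ match goal with
    | H : ord_ge _ _ 0 ?B |- ord_ge _ _ 0 ?B => exact H
    | |- ord_ge _ _ 0 (_ + _) => apply: ordD
    | |- ord_ge _ _ 0 (_ * _) => apply: ordMl
    | |- ord_ge _ _ 0 (- _) => apply: ordN
    | |- ord_ge _ _ 0 (?B ^+ ?e) => apply: (@ordX _ _ 0 e B)
    end ].

Section Perturbation.
Context (n : nat) (z : algC).
Hypothesis z_prim : n.-primitive_root z.
Implicit Types (A B y t g : ratfrac) (e : nat).
Local Notation ord_ge := (ord_ge n z).

Lemma binomial_order2 x r : ord_ge 0 x ->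
  exists2 c, ord_ge 0 c
    & (1 + x) ^+ r = 1 + r%:R * x + 'C(r, 2)%:R * x ^+ 2 + x ^+ 3 * c.
Proof.
move=> ox; elim: r => [|r [c oc Dc]].
  by exists 0; [apply: ord_zero | rewrite expr0 bin0n !mul0r mulr0 !addr0].
exists ('C(r, 2)%:R + c + x * c).
  apply: ordD; last exact: ordMl.
  by apply: ordD oc; apply: ord0_spec (spec_nat z _).
by rewrite exprSr Dc binS bin1 natrD -natr1; ring.
Qed.

(** Instead of (y - 1) ^+ 2, the second-order term uses (y - 1) * (1 - y^-1), which
    has the same leading term and is invariant under the inversion of y; numerators
    and denominators of the perturbed summands then have the same expansion. *)
Lemma pert_factor_expand y r t a : specializes z y 1 -> specializes z t a -> a != 1 ->
  ord_ge 3 (pert_factor y r t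
         - (1 - 'C(r.+1, 2)%:R * log_curv t * ((y - 1) * (1 - y^-1)))).
Proof.
move=> sy st a1.
have s1t : specializes z (1 - t) (1 - a) by apply: specB (spec1 z) st.
have a1' : 1 - a != 0 by rewrite subr_eq0 eq_sym.
have t1 : 1 - t != 0 := spec_neq0 s1t a1'.
have y0 : y != 0 by apply: spec_neq0 sy (oner_neq0 _).
have oy : ord_ge 0 y^-1 by apply: ord0_spec (specV _ sy); apply: oner_neq0.
set u := t / (1 - t); have ou : ord_ge 0 u by apply: ord0_spec (spec_div _ st s1t).
set w := y - 1; have ow : ord_ge 1 w.
  by apply: ord1_spec z_prim _ _; rewrite -(subrr 1); apply: specB sy (spec1 z).
have ow0 : ord_ge 0 w by apply: ord_leq ow.
have [c1 oc1 Dc1] := binomial_order2 r ow0.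
have owu : ord_ge 0 (- (u * w)) by apply: ordN; apply: ordMl.
have [c2 oc2 Dc2] := binomial_order2 r owu.
have on k : ord_ge 0 k%:R by apply: ord0_spec (spec_nat z k).
have o1 : ord_ge 0 1 by apply: on 1%N.
have br := mulr_bin2 ratfrac r.
have -> : 'C(r.+1, 2)%:R = 'C(r, 2)%:R + r%:R :> ratfrac by rewrite binS bin1 natrD.
have ob := on 'C(r, 2); have or := on r.
move: ob or br Dc1 Dc2; move: ('C(r, 2)%:R) (r%:R) => b r' ob or br Dc1 Dc2.
pose k := (b + r') * u * (1 + u).
pose v := b * u - u ^+ 2 * w * c2.
pose G := u * (c1 - u ^+ 2 * c2)
   + (1 + u) * u * ((b + w * c1) * (- r' + w * v) + r' * v)
   + k * (r' + b * w + w ^+ 2 * c1).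
have ok : ord_ge 0 k by rewrite /k; ord_regular.
have ov : ord_ge 0 v by rewrite /v; ord_regular.
have oG : ord_ge 0 G.
  by rewrite /G; ord_regular.
rewrite (pert_factor_identity y0 t1 br Dc1 Dc2).
apply: (ordMr (e := 3)); first exact: (ordX (e := 1)).
by rewrite -exprVn; ord_regular.
Qed.

Lemma ord_approx e A t : ord_ge e (A - (1 + t)) -> ord_ge 2 t -> ord_ge 0 A.
Proof.
move=> oA ot; have -> : A = A - (1 + t) + (1 + t) by rewrite subrK.
apply: ordD; first exact: ord_leq oA.
by apply: ordD; [apply: ord0_spec (spec1 z) | apply: ord_leq ot].
Qed.

(** Corrections of order 2 add up, since their products have order 4. *)
Lemma ord_prod_approx e k (F g : nat -> ratfrac) : (e <= 4)%N ->
    (forall i, (i < k)%N -> ord_ge 2 (g i) /\ ord_ge e (F i - (1 + g i))) ->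
  ord_ge e (\prod_(i < k) F i - (1 + \sum_(i < k) g i)).
Proof.
move=> le_e4; elim: k => [|k IHk] oFg.
  by rewrite !big_ord0 addr0 subrr; apply: ord_zero.
have {}IHk := IHk (fun i lt => oFg i (ltnW lt)).
have os : ord_ge 2 (\sum_(i < k) g i) by apply: ord_sum => i /ltnW/oFg[].
have [og oF] := oFg k (ltnSn k).
rewrite !big_ord_recr /=; set P := \prod_(i < k) _ in IHk *.
set s := \sum_(i < k) _ in IHk os *.
have -> : P * F k - (1 + (s + g k))
  = (P - (1 + s)) * F k + (1 + s) * (F k - (1 + g k)) + s * g k by ring.
apply: ordD; first apply: ordD.
- by apply: ordMr => //; apply: ord_approx oF og.
- apply: ordMl => //; apply: ordD; first exact: ord0_spec (spec1 z).
  exact: ord_leq os.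
- by apply: (ord_leq le_e4); apply: (ordM (e := 2)).
Qed.

Lemma ord_inv_approx A t : ord_ge 3 (A - (1 + t)) -> ord_ge 2 t -> ord_ge 3 (A^-1 - (1 - t)).
Proof.
move=> oA ot.
have oA1 : ord_ge 2 (A - 1).
  have -> : A - 1 = A - (1 + t) + t by ring.
  by apply: ordD ot; apply: ord_leq oA.
have sA : specializes z A 1.
  have := specD (ord_spec0 z_prim oA1) (spec1 z).
  by rewrite subrK add0r.
have A0 : A != 0 := spec_neq0 sA (oner_neq0 _).
have -> : A^-1 - (1 - t) = A^-1 * ((A - 1) * t - (A - (1 + t))).
  by rewrite !mulrBr mulrA mulrBr mulrDr mulr1 mulVf //; ring.
apply: ordMl; first exact: ord0_spec (specV (oner_neq0 _) sA).
by apply: ordB => //; apply: (ord_leq (e := 4)) => //; apply: (ordM (e := 2)).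
Qed.

Lemma ord_div_approx A t B s :
    ord_ge 3 (A - (1 + t)) -> ord_ge 2 t -> ord_ge 3 (B - (1 + s)) -> ord_ge 2 s ->
  ord_ge 3 (A / B - (1 + (t - s))).
Proof.
move=> oA ot oB os; have oB' := ord_inv_approx oB os.
have -> : A / B - (1 + (t - s))
   = (A - (1 + t)) * B^-1 + (1 + t) * (B^-1 - (1 - s)) - t * s by ring.
apply: ordB; first apply: ordD.
- apply: ordMr => //; apply: (ord_approx (t := - s)) (ordN os); exact: oB'.
- apply: ordMl => //; apply: ordD; first exact: ord0_spec (spec1 z).
  exact: ord_leq ot.
- by apply: (ord_leq (e := 4)) => //; apply: (ordM (e := 2)).
Qed.
End Perturbation.

(** * Reflection of the summands at a root of unity *)

Lemma log_curvV (K : fieldType) (t : K) : log_curv t^-1 = log_curv t.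
Proof.
have [-> | t0] := eqVneq t 0; first by rewrite invr0.
have [-> | t1] := eqVneq t 1; first by rewrite invr1.
rewrite /log_curv; field.
by rewrite t0 !subr_eq0 t1 eq_sym t1.
Qed.

(** In this section x plays the role of z ^+ d, and x ^- M that of z^-1. *)
Section Antisymmetry.
Context (K : fieldType) (x : K) (d h M : nat).
Hypothesis two_neq0 : 2 != 0 :> K.
Hypothesis x_neq0 : x != 0.
Hypothesis x_nroot : forall j, (0 < j <= M)%N -> x ^+ j != 1.
Hypothesis dE : d = (2 * h).+1.
Hypothesis x_dM : x ^+ (d * M) = x.
Hypothesis x_sign : x ^+ (d * 'C(M.+1, 2)) = (-1) ^+ M * x ^+ (h.+1 * M).

Let v k := qpoch (x ^- M) x k ^+ d / qpoch x x k ^+ d * x ^+ (h * k).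

Let sub_neq0 j : (0 < j <= M)%N -> 1 - x ^+ j != 0.
Proof. by move=> /x_nroot; rewrite subr_eq0 eq_sym. Qed.

Let x_poch k : (k <= M)%N -> qpoch x x k != 0.
Proof. by move=> leM; apply: qpoch_neq0 => i ltik; rewrite -exprS sub_neq0 //; lia. Qed.

(* The ratio of consecutive terms of v. *)
Let rho k := ((1 - x ^- M * x ^+ k) / (1 - x ^+ k.+1)) ^+ d * x ^+ h.

Let vS k : (k < M)%N -> v k.+1 = v k * rho k.
Proof.
move=> ltkM; rewrite /v /rho !qpochS -exprS mulnS exprD !exprMn !exprVn.
by field; rewrite !expf_neq0 ?sub_neq0 ?x_poch //; lia.
Qed.

Let rho_refl k : (k < M)%N -> rho k * rho (M - k.+1) = x ^- 2.
Proof.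
move=> ltkM; rewrite /rho.
set j := (M - k.+1)%N; have Mjk : M = (j + k.+1)%N by rewrite /j; lia.
have -> : (1 - x ^- M * x ^+ k) = - (1 - x ^+ j.+1) / x ^+ j.+1.
  by rewrite [in x ^- M]Mjk addnS -addSn exprD; field; rewrite !expf_neq0.
have -> : (1 - x ^- M * x ^+ j) = - (1 - x ^+ k.+1) / x ^+ k.+1.
  by rewrite [in x ^- M]Mjk exprD; field; rewrite !expf_neq0.
rewrite mulrACA -exprMn.
have -> : - (1 - x ^+ j.+1) / x ^+ j.+1 / (1 - x ^+ k.+1)
     * (- (1 - x ^+ k.+1) / x ^+ k.+1 / (1 - x ^+ j.+1)) = x ^- M.+1.
  rewrite [in RHS]Mjk -addSn exprD; field.
  by rewrite !expf_neq0 ?sub_neq0 //; lia.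
rewrite exprVn -exprM.
have -> : (M.+1 * d = d * M + (h + h).+1)%N by rewrite dE; nia.
by rewrite exprD x_dM exprS exprD; field; rewrite x_neq0 expf_neq0.
Qed.

(* The reflection of v is propagated from the end points, where it is the sign
   condition on x. *)
Let vM : v M = x ^- M.
Proof.
have -> : v M = (\prod_(j < M) (- x ^- j.+1)) ^+ d * x ^+ (h * M).
  rewrite /v -expr_div_n; congr (_ ^+ d * _).
  rewrite /qpoch [X in X / _](reindex_inj rev_ord_inj) -prodf_div /=.
  apply: eq_bigr => j _.
  have {1}-> : M = (j.+1 + (M - j.+1))%N by have := ltn_ord j; lia.
  rewrite exprD invfM mulfVK ?expf_neq0 // -exprS.
  by field; rewrite !expf_neq0 ?sub_neq0 //; have := ltn_ord j; lia.
have -> : \prod_(j < M) (- x ^- j.+1) = (-1) ^+ M * x ^- 'C(M.+1, 2).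
  elim: (M) => [|m IHm]; first by rewrite big_ord0 bin_small // !expr0 invr1 mulr1.
  rewrite big_ord_recr /= IHm [in RHS]binS bin1 exprD !exprS.
  by field; rewrite x_neq0 !expf_neq0.
rewrite exprMn exprVn -!exprM [('C(_, _) * d)%N]mulnC x_sign.
have -> : (-1) ^+ (M * d) = (-1) ^+ M :> K.
  by rewrite -signr_odd oddM dE /= oddM /= andbT signr_odd.
rewrite mulSn exprD; field.
by rewrite signr_eq0 !expf_neq0.
Qed.

Let v_refl k : (k <= M)%N -> v (M - k) = x ^+ (2 * k) / x ^+ M * v k.
Proof.
elim: k => [|k IHk] ltkM.
  by rewrite subn0 vM muln0 expr0 mul1r /v !qpoch0 expr1n muln0 expr0 divr1 !mulr1.
have rho0 : rho (M - k.+1) != 0.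
  have := rho_refl ltkM; apply: contra_eq_neq => ->.
  by rewrite mulr0 eq_sym invr_eq0 expf_neq0.
apply: (mulIf rho0); rewrite -vS; last lia.
rewrite (vS ltkM) [X in X * _]mulrA -[RHS]mulrA (rho_refl ltkM) -subSn // subSS IHk 1?ltnW //.
by rewrite mulnS exprD; field; rewrite x_neq0 !expf_neq0.
Qed.

Let t k := (1 - x ^- M * x ^+ (2 * k)) * v k.

Let t_refl k : (k <= M)%N -> t (M - k) = - t k.
Proof.
move=> leM; rewrite /t v_refl // mulnBr.
have -> : x ^+ (2 * M - 2 * k) = x ^+ M * x ^+ M / x ^+ (2 * k).
  by rewrite -exprD addnn -mul2n expfB_cond ?(negPf x_neq0) ?add0n ?leq_mul2l.
by field; rewrite !expf_neq0.
Qed.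

Let E k := \sum_(i < k) (log_curv (x * x ^+ i) - log_curv (x ^- M * x ^+ i)).

(* With H k the sum of the curvatures of x, ..., x ^+ k, which is the only part of E
   left after replacing each argument by its inverse where needed, E k equals
   H k + H (M - k) - H M. *)
Let E_refl k : (k <= M)%N -> E (M - k) = E k.
Proof.
pose H k := \sum_(i < k) log_curv (x ^+ i.+1).
have EH j : (j <= M)%N -> E j = H j + H (M - j)%N - H M.
  move=> lejM; rewrite /E sumrB; under eq_bigr do rewrite -exprS.
  rewrite -/(H j); suff -> : \sum_(i < j) log_curv (x ^- M * x ^+ i) = H M - H (M - j)%N.
    by rewrite opprB addrA addrAC.
  elim: j lejM => [|j IHj] lejM; first by rewrite big_ord0 subn0 subrr.
  rewrite big_ord_recr /= IHj; last lia.
  have -> : (M - j = (M - j.+1).+1)%N by lia.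
  rewrite {2 4}/H; rewrite big_ord_recr /= -/(H _).
  have -> : log_curv (x ^- M * x ^+ j) = log_curv (x ^+ (M - j.+1).+1).
    have {1}-> : M = ((M - j.+1).+1 + j)%N by lia.
    by rewrite exprD invfM mulfVK ?expf_neq0 // log_curvV.
  by rewrite opprD addrA addrNK.
move=> leM; rewrite !EH //; last by lia.
by rewrite subKn // [H k + _]addrC.
Qed.

Lemma antisym_sum : \sum_(k < M.+1) t k * E k = 0.
Proof.
apply: (mulfI two_neq0); rewrite mulr0 mulr_natl mulr2n.
rewrite [X in X + _](reindex_inj rev_ord_inj) -big_split big1 //= => k _.
have lek : (k <= M)%N by rewrite -ltnS.
by rewrite subSS (t_refl lek) (E_refl lek) mulNr addNr.
Qed.

End Antisymmetry.

(** * The truncated sum *)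

Lemma qvar_neq0 : qvar != 0.
Proof. by rewrite tofrac_eq0 polyX_eq0. Qed.

Lemma qvar_exp_neq i j : i != j -> qvar ^+ i != qvar ^+ j.
Proof.
apply: contraNneq; rewrite /qvar -!rmorphXn => /eqP; rewrite tofrac_eq => /eqP.
by move=> /(congr1 (fun p : {poly rat} => size p)); rewrite !size_polyXn => -[->].
Qed.

(** The perturbed summand has the shape required by [vwp_poly_sum]. *)
Lemma regroup_one_sided (K : fieldType) (c X A B C D : K) d r :
    d = r.+1 -> A != 0 -> B != 0 ->
  c * (A ^+ d / B ^+ d) * X * (C * D ^+ r / A ^+ r.+1)
    = c * (C / B) * (D / B) ^+ r * X.
Proof. by move=> -> A0 B0; rewrite expr_div_n !exprS; field; rewrite A0 B0 !expf_neq0. Qed.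

(** The perturbed summand has the shape required by [vwp_wp_sum]. *)
Lemma regroup_two_sided (K : fieldType) (c X A B C D C' D' : K) d r :
    d = r.+2 -> A != 0 -> B != 0 -> C' != 0 -> D' != 0 ->
  c * (A ^+ d / B ^+ d) * X * ((C * D ^+ r / A ^+ r.+1) / (C' * D' ^+ r / B ^+ r.+1))
    = c * (C * A / (B * C')) * (D / D') ^+ r * X.
Proof.
move=> -> A0 B0 C0 D0; rewrite expr_div_n !exprS.
by field; rewrite A0 B0 C0 !expf_neq0.
Qed.

Section TruncatedSum.
Context (d h n r M : nat) (z : algC).
Hypothesis dE : d = (2 * h).+1.
Hypothesis h_gt0 : (0 < h)%N.
Hypothesis n_gt1 : (1 < n)%N.
Hypothesis nd_coprime : coprime n d.
Hypothesis ltMn : (M < n)%N.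
Hypothesis dM : (d * M = (r * n).+1)%N.
Hypothesis z_prim : n.-primitive_root z.
Local Notation ord_ge := (ord_ge n z).

Local Notation q := qvar.
Local Notation Q := (q ^+ d).
Local Notation x := (z ^+ d).
Local Notation y := (q ^+ n).

(** The summand of the theorem multiplied by 1 - q. *)
Definition wp_term (k : nat) : ratfrac :=
  (1 - q^-1 * Q ^+ (2 * k)) * (qpoch q^-1 Q k ^+ d / qpoch Q Q k ^+ d) * Q ^+ (h * k).

Let Q_neq0 : Q != 0. Proof. by rewrite expf_neq0 ?qvar_neq0. Qed.

Let d_gt2 : (2 < d)%N. Proof. by rewrite dE; lia. Qed.

Let z_neq0 : z != 0.
Proof.
apply/eqP => z0; have := prim_expr_order z_prim.
by rewrite z0 expr0n; case: n n_gt1 => // n' _ /eqP; rewrite eq_sym oner_eq0.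
Qed.

Let x_neq0 : x != 0. Proof. by rewrite expf_neq0. Qed.

Let x_nroot j : (0 < j < n)%N -> x ^+ j != 1.
Proof.
move=> jn; rewrite -exprM -(prim_order_dvd z_prim) Gauss_dvdr //.
by apply/negP => /dvdn_leq; lia.
Qed.

Let xM : x ^+ M = z.
Proof. by rewrite -exprM dM exprS mulnC exprM (prim_expr_order z_prim) expr1n mulr1. Qed.

Let spec_q1 : specializes z q^-1 (x ^- M).
Proof. by rewrite xM; apply: specV (spec_q z). Qed.

Let spec_Q : specializes z Q x. Proof. by apply: specX; apply: spec_q. Qed.

Let spec_y : specializes z y 1.
Proof. by have := specX n (spec_q z); rewrite (prim_expr_order z_prim). Qed.

Let x_poch_neq0 k : (k < n)%N -> qpoch x x k != 0.
Proof.
move=> ltkn; apply: qpoch_neq0 => i ltik.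
by rewrite -exprS subr_eq0 eq_sym x_nroot //; lia.
Qed.

(* For i < M the exponent M - i of x is not a multiple of n. *)
Let alpha_neq1 i : (i < M)%N -> x ^- M * x ^+ i != 1.
Proof.
move=> ltiM; rewrite mulrC -[_ / _]invf_div -expfB // invr_eq1 x_nroot //; lia.
Qed.

Let beta_neq1 i : (i < M)%N -> x * x ^+ i != 1.
Proof. by move=> ltiM; rewrite -exprS x_nroot //; lia. Qed.

Let alpha_poch_neq0 k : (k <= M)%N -> qpoch q^-1 Q k != 0.
Proof.
move=> lekM; apply: (spec_neq0 (spec_qpoch k spec_q1 spec_Q)).
by apply: qpoch_neq0 => i ltik; rewrite subr_eq0 eq_sym alpha_neq1 //; lia.
Qed.

Let Q_poch_neq0 k : (k < n)%N -> qpoch Q Q k != 0.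
Proof.
by move=> ltkn; apply: (spec_neq0 (spec_qpoch k spec_Q spec_Q)); apply: x_poch_neq0.
Qed.

Lemma spec_wp_term k : (k < n)%N ->
  specializes z (wp_term k) ((1 - x ^- M * x ^+ (2 * k))
     * (qpoch (x ^- M) x k ^+ d / qpoch x x k ^+ d * x ^+ (h * k))).
Proof.
move=> ltkn; rewrite mulrA; apply: specM; last exact: specX.
apply: specM.
  by apply: specB (spec1 z) _; apply: specM => //; apply: specX.
apply: spec_div; rewrite ?expf_neq0 ?x_poch_neq0 //; apply: specX; exact: spec_qpoch.
Qed.

(** Each of the d factors (q^-1; q^d)_k contains 1 - q^-1 * q ^+ (d * M), which
    vanishes at z. *)
Lemma ord_wp_term_tail k : (M < k < n)%N -> ord_ge d (wp_term k).
Proof.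
move=> /andP[ltMk ltkn].
have o1 : ord_ge 1 (qpoch q^-1 Q k).
  apply: (ord1_spec z_prim); have := spec_qpoch k spec_q1 spec_Q.
  suff -> : qpoch (x ^- M) x k = 0 by [].
  apply/eqP/prodf_eq0; exists (Ordinal ltMk) => //=.
  by rewrite mulVf ?expf_neq0 // subrr.
have o2 := ordX d o1; rewrite mul1n in o2.
rewrite /wp_term; apply: ordMr; last by apply: ord0_spec (specX _ spec_Q).
apply: ordMl.
  by apply: ord0_spec (specB (spec1 z) (specM spec_q1 (specX _ spec_Q))).
apply: ordMr o2 _; apply: ord0_spec (specV _ (specX d (spec_qpoch k spec_Q spec_Q))).
by rewrite expf_neq0 ?x_poch_neq0.
Qed.

Lemma ord_wp_sum_truncate e : (e <= d)%N ->
  ord_ge e (\sum_(k < M.+1) wp_term k) -> ord_ge e (\sum_(k < n) wp_term k).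
Proof.
have split N : (N = M.+1 + (n - M.+1))%N -> \sum_(k < N) wp_term k
   = \sum_(k < M.+1) wp_term k + \sum_(k < n - M.+1) wp_term (M.+1 + k).
  by move->; rewrite big_split_ord.
move=> le_ed oM; rewrite (split n) ?subnKC //.
apply: ordD oM _; apply: (ord_sum (F := fun i => wp_term (M.+1 + i))) => i lti.
by apply: ord_leq le_ed _; apply: ord_wp_term_tail; lia.
Qed.

Let eta := (y - 1) * (1 - y^-1).

Let spec_y1 : specializes z y^-1 1.
Proof. by have := specV (oner_neq0 _) spec_y; rewrite invr1. Qed.

Let ord_eta : ord_ge 2 eta.
Proof.
apply: (ordM (e := 1)); apply: (ord1_spec z_prim); rewrite -(subrr 1).
  exact: specB spec_y (spec1 z).
exact: specB (spec1 z) spec_y1.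
Qed.

Let cr : ratfrac := 'C(r.+1, 2)%:R.

Let spec_log_curv t a : a != 1 -> specializes z t a -> specializes z (log_curv t) (log_curv a).
Proof.
move=> a1 st; have nz : (1 - a) ^+ 2 != 0 by rewrite expf_neq0 // subr_eq0 eq_sym.
exact: spec_div nz st (specX 2 (specB (spec1 z) st)).
Qed.

Let ord_curv t a : specializes z t a -> a != 1 -> ord_ge 2 (cr * log_curv t * eta).
Proof.
move=> st a1; apply: ordMl => //.
exact: ord0_spec (specM (spec_nat z _) (spec_log_curv a1 st)).
Qed.

Let pert_alpha i : (i < M)%N -> let t := q^-1 * Q ^+ i in
  ord_ge 2 (- (cr * log_curv t * eta))
  /\ ord_ge 3 (pert_factor y r t - (1 + - (cr * log_curv t * eta))).
Proof.
move=> ltiM /=; have st : specializes z (q^-1 * Q ^+ i) (x ^- M * x ^+ i).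
  by exact: specM spec_q1 (specX _ spec_Q).
have a1 := alpha_neq1 ltiM; split; first by apply: ordN; apply: ord_curv st a1.
exact: (pert_factor_expand z_prim r spec_y st a1).
Qed.

Let pert_beta i : (i < M)%N -> let t := Q * Q ^+ i in
  ord_ge 2 (- (cr * log_curv t * eta))
  /\ ord_ge 3 (pert_factor y^-1 r t - (1 + - (cr * log_curv t * eta))).
Proof.
move=> ltiM /=; have st : specializes z (Q * Q ^+ i) (x * x ^+ i).
  by exact: specM spec_Q (specX _ spec_Q).
have a1 := beta_neq1 ltiM; split; first by apply: ordN; apply: ord_curv st a1.
have -> : eta = (y^-1 - 1) * (1 - y^-1^-1) by rewrite /eta invrK; ring.
exact: (pert_factor_expand z_prim r spec_y1 st a1).
Qed.

Let QM : q^-1 / y ^+ r = Q ^- M.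
Proof. by rewrite -invfM -!exprM -exprS dM mulnC. Qed.

(** The perturbed sum vanishes identically, and each summand differs from the
    original one by a term of order 2. *)
Lemma ord2_wp_sum m : d = r.+1 -> n = (d * m).+1 ->
  ord_ge 2 (\sum_(k < M.+1) wp_term k).
Proof.
move=> dr nm.
have ry : q^-1 * y = Q ^+ m.
  by rewrite nm exprS mulKf ?qvar_neq0 // exprM.
have r2h : r = (2 * h)%N by lia.
have Mm : M = (r * m).+1 by apply/eqP; rewrite -(@eqn_pmul2l d) ?dM ?nm; nia.
pose P k := \prod_(i < k) pert_factor y r (q^-1 * Q ^+ i).
have sum0 : \sum_(k < M.+1) wp_term k * P k = 0.
  have Q_nroot j : (0 < j <= M)%N -> Q ^+ j != 1.
    by move=> j0; rewrite -exprM -(expr0 q) qvar_exp_neq //; nia.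
  rewrite Mm in Q_nroot; have h_lt : (0 < h < r)%N by lia.
  have m_gt0 : (0 < m)%N by lia.
  have := vwp_poly_sum q^-1 Q_neq0 h_lt m_gt0 Q_nroot; rewrite -Mm => V; rewrite -[RHS]V.
  apply: eq_bigr => k _; have lekM : (k <= M)%N by rewrite -ltnS.
  rewrite /P prod_pert_factor QM ry /wp_term -mul2n.
  have nzQ : qpoch Q Q k != 0 by apply: Q_poch_neq0; lia.
  by rewrite (regroup_one_sided _ _ _ _ dr (alpha_poch_neq0 lekM) nzQ).
have -> : \sum_(k < M.+1) wp_term k = \sum_(k < M.+1) (wp_term k - wp_term k * P k).
  by rewrite sumrB sum0 subr0.
apply: (ord_sum (F := fun k => wp_term k - wp_term k * P k)) => k ltk.
have -> : wp_term k - wp_term k * P k = - (wp_term k * (P k - 1)) by ring.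
apply: ordN; apply: ordMl; first by apply: ord0_spec (spec_wp_term _); lia.
have oF i : (i < k)%N -> ord_ge 2 0 /\ ord_ge 2 (pert_factor y r (q^-1 * Q ^+ i) - (1 + 0)).
  move=> ltik; split; first exact: ord_zero.
  have [] := @pert_alpha i; first by lia.
  set t := - _ => ot oN; rewrite addr0.
  have -> : pert_factor y r (q^-1 * Q ^+ i) - 1
     = pert_factor y r (q^-1 * Q ^+ i) - (1 + t) + t by ring.
  by apply: ordD ot; apply: ord_leq oN.
have := ord_prod_approx (g := fun=> 0) (isT : (2 <= 4)%N) oF.
by rewrite [X in 1 + X]big1 // addr0.
Qed.

(* For odd M the number n is even and z ^+ (n./2) = -1; for even M both sides agree
   because the exponents differ by a multiple of n. *)
Let x_sign : d = r.+2 -> x ^+ (d * 'C(M.+1, 2)) = (-1) ^+ M * x ^+ (h.+1 * M).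
Proof.
move=> dr; have C2 : 'C(M.+1, 2).*2 = (M.+1 * M)%N.
  by rewrite bin2 -[RHS]odd_double_half oddM /= andNb.
have Mu := odd_double_half M; set u := M./2 in Mu.
have oddd : odd d by rewrite dE /= oddM.
have zn := prim_expr_order z_prim.
rewrite -(signr_odd _ M); case oM : (odd M) in Mu *.
  have oddr : odd r by move: oddd; rewrite dr /= negbK.
  have oddn : ~~ odd n.
    have := congr1 odd dM; rewrite /= !oddM oddd oM oddr /= => /esym.
    by case: (odd n).
  have := odd_double_half n; rewrite (negPf oddn) add0n; set w := n./2 => nw.
  have zw : z ^+ w = -1.
    have zw2 : (z ^+ w - 1) * (z ^+ w + 1) = 0.
      by rewrite -subr_sqr -exprM muln2 nw zn expr1n subrr.
    move/eqP: zw2; rewrite mulf_eq0 subr_eq0 -(prim_order_dvd z_prim).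
    rewrite gtnNdvd ?addr_eq0; [by move/eqP | lia | lia].
  have -> : (d * 'C(M.+1, 2) = h.+1 * M + M * r * w)%N by nia.
  rewrite exprD mulrC; congr (_ * _).
  by rewrite -exprM mulnA mulnC exprM zw -[LHS]signr_odd !oddM oddd oM oddr.
have -> : (d * 'C(M.+1, 2) = h.+1 * M + u * r * n)%N by nia.
rewrite exprD mulrC; congr (_ * _).
by rewrite -exprM mulnA mulnC exprM zn expr1n.
Qed.

(** The perturbed sum vanishes identically, and up to order 3 the difference with the
    original sum is an element of order 2 times the sum of wp_term k * E k, which
    vanishes at z by antisymmetry. *)
Lemma ord3_wp_sum l : d = r.+2 -> (d * l.*2.+1).+1 = n.*2 ->
  ord_ge 3 (\sum_(k < M.+1) wp_term k).
Proof.
move=> dr nl.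
have ry : q^-1 * y = y^-1 * Q ^+ l.*2.+1.
  have y0 : y != 0 by rewrite expf_neq0 ?qvar_neq0.
  apply: (mulfI y0); rewrite mulVKf // mulrCA -exprD -exprM.
  by apply: (mulfI qvar_neq0); rewrite mulVKf ?qvar_neq0 // -exprS nl -addnn.
have Qy : Q / y^-1 ^+ r = q^-1 * Q ^+ M.+1.
  apply: (mulfI qvar_neq0); rewrite mulVKf ?qvar_neq0 // exprVn invrK.
  by rewrite -!exprM -exprD -exprS; congr (q ^+ _); rewrite mulnS dM; lia.
have Mhl : M = (h + r * l)%N by nia.
have y_ok j : 1 - y^-1 * Q ^+ j != 0.
  rewrite subr_eq0 eq_sym mulrC -(inj_eq (mulIf (expf_neq0 n qvar_neq0))) mulfVK ?expf_neq0 ?qvar_neq0 //.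
  rewrite mul1r -exprM qvar_exp_neq //; apply/eqP => djn.
  by move: nd_coprime; rewrite -djn /coprime gcdnC gcdnMr; lia.
have q_ok j : 1 - q^-1 * Q ^+ j != 0.
  rewrite subr_eq0 eq_sym mulrC -(inj_eq (mulIf qvar_neq0)) mulfVK ?qvar_neq0 //.
  rewrite mul1r -exprM; apply: (@qvar_exp_neq _ 1).
  by case: j => [|j]; rewrite ?muln0 // mulnS; lia.
pose P k := \prod_(i < k) (pert_factor y r (q^-1 * Q ^+ i) / pert_factor y^-1 r (Q * Q ^+ i)).
have sum0 : \sum_(k < M.+1) wp_term k * P k = 0.
  have Q_nroot j : (0 < j <= M)%N -> Q ^+ j != 1.
    by move=> j0; rewrite -exprM -(expr0 q) qvar_exp_neq //; nia.
  have yq : y^-1 ^+ 2 * Q ^+ l.*2.+1 = q^-1.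
    by rewrite expr2 -mulrA -ry mulrCA mulVf ?mulr1 ?expf_neq0 ?qvar_neq0.
  have a_ok j : (j <= M.*2)%N -> 1 - q^-1 * Q ^+ j != 0.
    by move=> _; apply: q_ok.
  rewrite Mhl in Q_nroot a_ok; have := vwp_wp_sum Q_neq0 h_gt0 yq Q_nroot a_ok y_ok.
  rewrite -Mhl => V; rewrite -[RHS]V.
  apply: eq_bigr => k _; have lekM : (k <= M)%N by rewrite -ltnS.
  rewrite /P prodf_div !prod_pert_factor QM Qy ry /wp_term -[(nat_of_ord k).*2]mul2n [Q * y^-1]mulrC.
  have nzQ : qpoch Q Q k != 0 by apply: Q_poch_neq0; lia.
  have nzC : qpoch (q^-1 * Q ^+ M.+1) Q k != 0.
    by apply: qpoch_neq0 => i _; rewrite -mulrA -exprD; apply: q_ok.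
  have nzD : qpoch (y^-1 * Q) Q k != 0.
    by apply: qpoch_neq0 => i _; rewrite -mulrA -exprS; apply: y_ok.
  by rewrite (regroup_two_sided _ _ _ _ dr (alpha_poch_neq0 lekM) nzQ nzC nzD).
pose E k := \sum_(i < k) (log_curv (Q * Q ^+ i) - log_curv (q^-1 * Q ^+ i)).
have P_approx k : (k <= M)%N -> ord_ge 3 (P k - (1 + cr * eta * E k)).
  move=> lekM.
  have -> : cr * eta * E k = \sum_(i < k) (- (cr * log_curv (q^-1 * Q ^+ i) * eta)
       - - (cr * log_curv (Q * Q ^+ i) * eta)).
    by rewrite /E mulr_sumr; apply: eq_bigr => i _; ring.
  apply: (ord_prod_approx (F := fun i => pert_factor y r (q^-1 * Q ^+ i) / pert_factor y^-1 r (Q * Q ^+ i))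
    (g := fun i : nat => (- (cr * log_curv (q^-1 * Q ^+ i) * eta)
       - - (cr * log_curv (Q * Q ^+ i) * eta)))) => // i ltik.
  have ltiM : (i < M)%N by lia.
  have [oa oN] := pert_alpha ltiM; have [ob oD] := pert_beta ltiM.
  by split; [apply: ordB | apply: ord_div_approx].
have E_sum : ord_ge 1 (\sum_(k < M.+1) wp_term k * E k).
  apply: (ord1_spec z_prim).
  have x_nroot' j : (0 < j <= M)%N -> x ^+ j != 1 by move=> jM; apply: x_nroot; lia.
  have x_dM : x ^+ (d * M) = x by rewrite mulnC exprM xM.
  have two_neq0 : 2 != 0 :> algC by rewrite pnatr_eq0.
  have := antisym_sum two_neq0 x_neq0 x_nroot' dE x_dM (x_sign dr) => /= <-.
  apply: (spec_sum (F := fun k => wp_term k * E k)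
    (f := fun k => (1 - x ^- M * x ^+ (2 * k))
       * (qpoch (x ^- M) x k ^+ d / qpoch x x k ^+ d * x ^+ (h * k))
       * \sum_(i < k) (log_curv (x * x ^+ i) - log_curv (x ^- M * x ^+ i)))) => k ltk.
  apply: specM; first by apply: spec_wp_term; lia.
  apply: (spec_sum (F := fun i => log_curv (Q * Q ^+ i) - log_curv (q^-1 * Q ^+ i))
    (f := fun i => log_curv (x * x ^+ i) - log_curv (x ^- M * x ^+ i))) => i ltik.
  have ltiM : (i < M)%N by lia.
  apply: specB; apply: spec_log_curv.
  - exact: beta_neq1.
  - exact: specM spec_Q (specX _ spec_Q).
  - exact: alpha_neq1.
  - exact: specM spec_q1 (specX _ spec_Q).
have -> : \sum_(k < M.+1) wp_term k
  = - \sum_(k < M.+1) wp_term k * (P k - (1 + cr * eta * E k))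
    - cr * eta * \sum_(k < M.+1) wp_term k * E k.
  have -> : \sum_(k < M.+1) wp_term k = \sum_(k < M.+1) (wp_term k - wp_term k * P k).
    by rewrite sumrB sum0 subr0.
  rewrite mulr_sumr -!sumrN -!big_split /=; apply: eq_bigr => k _.
  by move: (wp_term k) (P k) (E k) => w p e; ring.
apply: ordB; first apply: ordN.
  apply: (ord_sum (F := fun k => wp_term k * (P k - (1 + cr * eta * E k)))) => k ltk.
  by apply: ordMl (P_approx _ _); [apply: ord0_spec (spec_wp_term _) |]; lia.
apply: (ordM (e := 2) (f := 1)) E_sum; apply: ordMl => //.
exact: ord0_spec (spec_nat z _).
Qed.

End TruncatedSum.

(** * The congruences *)

Lemma sum_wp_term d h n : d = (2 * h).+1 ->
  \sum_(0 <= k < n)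
     qint qvar ((2 * d * k)%N%:Z - 1)
     * (qpoch qvar^-1 (qvar ^+ d) k ^+ d / qpoch (qvar ^+ d) (qvar ^+ d) k ^+ d)
     * qvar ^+ ((d * (d - 1) * k) %/ 2)%N
  = (1 - qvar)^-1 * \sum_(k < n) wp_term d h k.
Proof.
move=> dE; rewrite big_mkord mulr_sumr; apply: eq_bigr => k _.
rewrite /qint expfzDr ?qvar_neq0 // exprN1 -exprnP /wp_term.
have -> : ((d * (d - 1) * k) %/ 2 = d * (h * k))%N.
  rewrite -[RHS](@mulnK _ 2) //; congr (_ %/ 2)%N.
  by rewrite -!mulnA; congr (_ * _)%N; rewrite dE subn1 /=; lia.
have -> : (2 * d * k = d * (2 * k))%N by rewrite mulnCA mulnA.
rewrite !exprM.
by rewrite [_ / qvar]mulrC [_ / (1 - qvar)]mulrC -!mulrA.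
Qed.

Theorem theorem2 (d n : nat) (hd : (3 <= d)%N) (hodd : odd d) (hn : (1 < n)%N) :
  let q := qvar in
  let S := \sum_(0 <= k < n)
             qint q ((2 * d * k)%N%:Z - 1)
             * (qpoch q^-1 (q ^+ d) k ^+ d / qpoch (q ^+ d) (q ^+ d) k ^+ d)
             * q ^+ ((d * (d - 1) * k) %/ 2)%N in
  (n = 1 %[mod d] -> ratfrac_congr0 S (PhiQ n ^+ 2)) /\
  ((2 * n)%N = 1 %[mod d] -> ratfrac_congr0 S (PhiQ n ^+ 3)).
Proof.
move=> q S.
have [z z_prim] := C_prim_root_exists (ltnW hn).
have [h dE] : exists h, d = (2 * h).+1.
  by exists d./2; rewrite mul2n -[LHS]odd_double_half hodd.
have h_gt0 : (0 < h)%N by lia.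
have div1 N : N = 1 %[mod d] -> N = (d * (N %/ d)).+1.
  move=> N1; rewrite [LHS](divn_eq _ d) N1 (modn_small (_ : 1 < d)%N) ?addn1 1?mulnC //; lia.
have ord_S e : ord_ge n z e (\sum_(k < n) wp_term d h k) -> ratfrac_congr0 S (PhiQ n ^+ e).
  move=> oS; apply: (ord_congr0 z_prim); rewrite /S (sum_wp_term _ dE).
  apply: ordMl oS; apply: ord0_spec (specV _ (specB (spec1 z) (spec_q z))).
  rewrite subr_eq0 eq_sym -[z]expr1 -(prim_order_dvd z_prim) gtnNdvd //.
split=> [/div1|/div1]; set m := (_ %/ d)%N => nm.
- have cop : coprime n d by rewrite nm -addn1 mulnC coprime_sym /coprime gcdnMDl gcdn1.
  have ltM : (n - m < n)%N by case: (m) nm; lia.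
  have dM : (d * (n - m) = (d.-1 * n).+1)%N.
    have dn : (d * n = n + d.-1 * n)%N by rewrite -mulSn prednK //; lia.
    by rewrite mulnBr dn; move: (d * m)%N (d.-1 * n)%N nm => a b; lia.
  apply: ord_S; apply: (ord_wp_sum_truncate dE h_gt0 hn cop ltM dM z_prim); first by lia.
  by apply: (@ord2_wp_sum d h n d.-1 (n - m) z dE h_gt0 hn cop ltM dM z_prim m); lia.
- have cop : coprime n d.
    have : coprime d (2 * n) by rewrite nm -addn1 mulnC /coprime gcdnMDl gcdn1.
    by rewrite coprimeMr => /andP[_]; rewrite coprime_sym.
  have oddm : odd m by have := congr1 odd nm; rewrite /= !oddM hodd /= => /esym/negbFE.
  have mE : m = (m./2).*2.+1 by rewrite -[LHS]odd_double_half oddm.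
  have ltM : (n - m < n)%N by case: (m) nm; lia.
  have dM : (d * (n - m) = (d.-2 * n).+1)%N.
    have dn : (d * n = 2 * n + d.-2 * n)%N by rewrite -mulnDl; congr (_ * _)%N; lia.
    by rewrite mulnBr dn; move: (d * m)%N (d.-2 * n)%N nm => a b; lia.
  apply: ord_S; apply: (ord_wp_sum_truncate dE h_gt0 hn cop ltM dM z_prim); first by lia.
  apply: (@ord3_wp_sum d h n d.-2 (n - m) z dE h_gt0 hn cop ltM dM z_prim m./2); first lia.
  by rewrite -mE -mul2n.
Qed.
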